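(* Let $G$ be an odd-linked graph of order $n$. Then: (1) $G$ has a perfect matching; (2) $\alpha(G)=\frac{n-2}{2}$; (3) $\mathrm{core}(G)=\emptyset$; (4) $\mathrm{corona}(G)=V(G)$.
   Context: All graphs are finite, simple and undirected. $\alpha(G)$ is the maximum size of an independent set of $G$; $\mathrm{core}(G)$ and $\mathrm{corona}(G)$ are the intersection and the union, respectively, of all maximum independent sets of $G$. A graph $G$ is $2$-bicritical if $|N(S)|>|S|$ for every nonempty independent set $S\subseteq V(G)$, where $N(S)=\bigcup_{v\in S}N(v)$. Let $H$ be a subgraph of $G$. An ear with respect to $H$ is an odd-length path whose endpoints lie in $H$ and whose internal vertices are distinct and lie outside $H$. A pendant with respect to $H$ is an odd cycle $D$, vertex-disjoint from $H$, together with a simple path of positive length with one end in $D$ and the other in $H$, all of whose other vertices lie outside both $H$ and $D$. A connected $2$-bicritical graph $G$ with exactly two odd cycles (counted as subgraphs) is an odd-linked graph if there is a sequence $G_0,G_1,\dots,G_p=G$ such that $G_0$ is an odd cycle, $G_1$ is obtained from $G_0$ by adding a pendant, $G_i$ is obtained from $G_{i-1}$ by adding an ear for $i=2,\dots,p$, and the path of $G_1$ that connects its two odd cycles has odd length. *)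

(* Defs.v *)
From mathcomp Require Import all_boot all_order all_algebra.
Set Implicit Arguments.
Unset Strict Implicit.
Unset Printing Implicit Defensive.

Record sgraph := SGraph {
  vertex :> finType;
  adj : rel vertex;
  adj_sym : symmetric adj;
  adj_irr : irreflexive adj }.

Section Graphs.
Variable G : sgraph.
Implicit Types (S M : {set G}) (x y z : G) (s c : seq G).

Definition edges : {set {set G}} :=
  [set [set u.1; u.2] | u : G * G & adj u.1 u.2].

Definition connected : Prop := forall x y, connect (@adj G) x y.

Definition independent S : bool :=
  [forall x in S, forall y in S, ~~ adj x y].

Definition alpha : nat := \max_(S : {set G} | independent S) #|S|.

Definition max_independent_sets : {set {set G}} :=
  [set S | independent S & #|S| == alpha].

Definition core : {set G} := \bigcap_(S in max_independent_sets) S.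
Definition corona : {set G} := \bigcup_(S in max_independent_sets) S.

Definition neighbours S : {set G} := \bigcup_(v in S) [set w | adj v w].

Definition bicritical2 : Prop :=
  forall S, S != set0 -> independent S -> #|S| < #|neighbours S|.

Definition matching (M : {set {set G}}) : Prop := M \subset edges /\ trivIset M.

Definition perfect_matching (M : {set {set G}}) : Prop :=
  matching M /\ cover M = [set: G].

(* A vertex set together with an edge set.  Only values that are genuine
   subgraphs of [G] (unions of cycles and paths of [G]) occur below. *)
Definition subgraph := ({set G} * {set {set G}})%type.
Implicit Types H C : subgraph.

Definition whole : subgraph := ([set: G], edges).

Definition union H1 H2 : subgraph := (H1.1 :|: H2.1, H1.2 :|: H2.2).

Definition cycle_graph c : subgraph :=
  ([set x in c], [set [set x; next c x] | x in c]).

(* The path (or walk) [x :: s]; its length is [size s]. *)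
Definition path_graph x s : subgraph :=
  ([set z in x :: s], [set [set u.1; u.2] | u in zip (x :: s) s]).

Definition odd_cycle c : Prop :=
  [/\ ucycle (@adj G) c, 2 < size c & odd (size c)].

Definition is_odd_cycle_graph C : Prop :=
  exists2 c, odd_cycle c & C = cycle_graph c.

(* Cycles are counted as subgraphs, so irrespective of starting point and
   direction. *)
Definition exactly_two_odd_cycles : Prop :=
  exists C1 C2, C1 <> C2 /\
    forall C, is_odd_cycle_graph C <-> C = C1 \/ C = C2.

(* The path runs from [x] to [y] with internal vertices [s]; [x = y] is
   allowed. *)
Definition is_ear H x s y : Prop :=
  [/\ path (@adj G) x (rcons s y), odd (size (rcons s y)),
      x \in H.1 /\ y \in H.1, uniq s
    & {in s, forall z, z \notin H.1}].

Definition add_ear H H' : Prop :=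
  exists x s y, is_ear H x s y /\ H' = union H (path_graph x (rcons s y)).

(* The pendant consists of the cycle [c] and the path from [x] on [c] to [y] in
   [H] with internal vertices [s]. *)
Definition is_pendant H c x s y : Prop :=
  [/\ odd_cycle c, {in c, forall z, z \notin H.1},
      path (@adj G) x (rcons s y) /\ uniq (x :: rcons s y),
      x \in c /\ y \in H.1
    & {in s, forall z, z \notin H.1 /\ z \notin c}].

(* When [H] is an odd cycle, the pendant path is the path of [H'] connecting its
   two odd cycles. *)
Definition add_pendant_odd_path H H' : Prop :=
  exists c x s y, [/\ is_pendant H c x s y,
    H' = union H (union (cycle_graph c) (path_graph x (rcons s y)))
    & odd (size (rcons s y))].

Definition odd_linked : Prop :=
  [/\ connected, bicritical2, exactly_two_odd_cycles
    & exists (p : nat) (H : nat -> subgraph),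
      [/\ 0 < p, is_odd_cycle_graph (H 0), add_pendant_odd_path (H 0) (H 1),
          (forall i, 2 <= i <= p -> add_ear (H i.-1) (H i))
        & H p = whole]].

End Graphs.

Arguments alpha : clear implicits.
Arguments core : clear implicits.
Arguments corona : clear implicits.
Arguments odd_linked : clear implicits.

(* Main.v *)
Require Import Defs.
From mathcomp Require Import all_boot all_order all_algebra.
From mathcomp Require Import zify.

Set Implicit Arguments.
Unset Strict Implicit.
Unset Printing Implicit Defensive.

(** Let [P] be the odd path from [x] on the one odd cycle to [y] on the other.
    Matching the vertices of [P] along [P], and the rest of each cycle and the
    interior of each ear along itself, gives a perfect matching that avoids the
    edges [xx'] and [yy'] to the next vertices on the cycles.  Without these two [G] has no odd cycle
    left, hence is bipartite, and the matching forces both classes to have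
    [n/2] vertices.  Each deleted edge lies inside one class, and these classes
    are distinct because [P] is odd.  So in each class, dropping either end of
    its deleted edge leaves an independent set of [G] of size [n/2 - 1]; these
    sets cover [V(G)].  They are maximum: an independent set [S] of size [n/2]
    would have [|N(S)| <= |S|], against 2-bicriticality. *)

(** * Odd closed walks and two-colourings *)

Lemma nonuniq_split (T : eqType) (s : seq T) :
  ~~ uniq s -> exists x s1 s2 s3, s = s1 ++ x :: s2 ++ x :: s3.
Proof.
elim: s => // x s IHs /=; rewrite negb_and negbK.
have [/splitPr[s1 s2] _|_ /IHs[y [s1 [s2 [s3 ->]]]]] := boolP (x \in s).
  by exists x, [::], s1, s2.
by exists y, (x :: s1), s2, s3.
Qed.

(* A closed walk with a repeated vertex splits there into two shorter ones. *)
Lemma odd_closed_walk_cycle (T : eqType) (e : rel T) (c : seq T) :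
  irreflexive e -> cycle e c -> odd (size c) ->
  exists c', [/\ ucycle e c', 2 < size c' & odd (size c')].
Proof.
move=> irr; have [n] := ubnP (size c); elim: n c => // n IHn c le_c ec odd_c.
have [uc|/nonuniq_split[x [s1 [s2 [s3 Dc]]]]] := boolP (uniq c).
  exists c; split; rewrite ?/ucycle ?ec //.
  (* Among odd lengths only 1 has to be excluded, and that would be a loop. *)
  by case: c ec odd_c {le_c uc} => [|x [|y [|z c]]] //=; rewrite irr.
have : cycle e (rot (size s1) c) by rewrite rot_cycle.
rewrite Dc rot_size_cat /= -!catA /= rcons_cat /= cat_path /= => /and3P[p2 e2 p3].
have Ds : size c = (size s2).+1 + (size (s3 ++ s1)).+1.
  by rewrite Dc !size_cat /= !size_cat /=; lia.
have := odd_c; rewrite Ds oddD.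
have [odd2 _|_] := boolP (odd (size s2).+1).
  by apply: (IHn (x :: s2)) => //=; [lia | rewrite rcons_path p2].
rewrite addFb => odd3; apply: (IHn (x :: s3 ++ s1)) => //=; lia.
Qed.

Lemma no_odd_cycle_coloring (T : finType) (e : rel T) :
    symmetric e -> irreflexive e ->
    (forall c, ucycle e c -> 2 < size c -> ~~ odd (size c)) ->
  exists f : T -> bool, forall u v, e u v -> f u != f v.
Proof.
move=> sym irr noodd.
(* In the double cover [e2], parity of walks becomes reachability. *)
pose e2 (p q : T * bool) := e p.1 q.1 && (p.2 != q.2).
have sym2 : connect_sym e2.
  by apply: sym_connect_sym => p q; rewrite /e2 sym eq_sym.
have walk p q : connect e2 p q ->
  exists s, [/\ path e p.1 s, last p.1 s = q.1 & odd (size s) = (p.2 != q.2)].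
  case/connectP=> s; elim: s p => [|r s IHs] p /= => [_ ->|].
    by exists [::]; rewrite eqxx.
  case/andP=> /andP[epr pr] /IHs{}IHs /IHs[t [pt lt ot]].
  exists (r.1 :: t); split; rewrite /= ?epr //.
  by rewrite ot; case: (p.2) (r.2) (q.2) pr => [] [] [].
have no_closed u b : ~~ connect e2 (u, b) (u, ~~ b).
  apply/negP=> /walk[s /= [ps ls os]].
  have {}os: odd (size s) by rewrite os; case: (b).
  have es : cycle e s.
    by case: s ps ls {os} => //= x s /andP[ux px] lx; rewrite rcons_path px lx.
  have [c [uc c2 oc]] := odd_closed_walk_cycle irr es os.
  by move: (noodd c uc c2); rewrite oc.
have lift u v : connect e u v -> exists b, connect e2 (u, false) (v, b).
  case/connectP=> s ps ->; elim/last_ind: s ps => [|s x IHs] /=.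
    by exists false; apply: connect0.
  rewrite rcons_path last_rcons => /andP[/IHs[b cb] ex].
  exists (~~ b); apply: connect_trans cb (connect1 _).
  by rewrite /e2 /= ex; case: (b).
(* A vertex is coloured [true] when an odd walk reaches it from the root of its component. By [lift]
   some parity always occurs, and by [no_closed] never both. *)
exists (fun u => connect e2 (fingraph.root e u, false) (u, true)) => u v euv.
have csym : connect_sym e by apply: sym_connect_sym.
have -> : fingraph.root e v = fingraph.root e u by apply/esym/eqP; rewrite root_connect ?connect1.
have step b : connect e2 (u, b) (v, ~~ b).
  by apply: connect1; rewrite /e2 /= euv; case: (b).
set r := (fingraph.root e u, false).
have [ru|ru] := boolP (connect e2 r (u, true)); apply/eqP => rv.
  have := no_closed v true; rewrite (connect_trans _ (connect_trans ru (step _))) //.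
  by rewrite sym2 -rv.
have [|[] rub] := lift (fingraph.root e u) u; first by rewrite csym connect_root.
  by rewrite rub in ru.
by rewrite (connect_trans rub (step _)) in rv.
Qed.

(** * Matchings as lists of consecutive pairs *)

(** As a flat list, a matching is assembled from paths and ears by concatenation, and [uniq] with
    full membership makes it perfect. The relation is a parameter because the same list serves in
    [G] and in [G] without the two deleted edges. *)
Inductive paired (T : Type) (e : rel T) : seq T -> Prop :=
| paired_nil : paired e [::]
| paired_cons a b s : e a b -> paired e s -> paired e (a :: b :: s).

Lemma paired_cat (T : Type) (e : rel T) s t :
  paired e s -> paired e t -> paired e (s ++ t).
Proof. by move=> + pt; elim=> //= a b u eab _; apply: paired_cons. Qed.

Lemma paired_path (T : Type) (e : rel T) x s :
  path e x s -> odd (size s) -> paired e (x :: s).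
Proof.
have [n] := ubnP (size s); elim: n x s => // n IHn x [|y [|z s]] //=.
  by move=> _ /andP[exy _] _; apply: paired_cons => //; apply: paired_nil.
rewrite negbK => le_s /and3P[exy _ pz] os; apply: paired_cons => //.
by apply: IHn => //; lia.
Qed.

(** An odd path has an even number of internal vertices, so dropping both end edges leaves either
    nothing or an odd path. *)
Lemma paired_internal (T : Type) (e : rel T) x s y :
  path e x (rcons s y) -> odd (size (rcons s y)) -> paired e s.
Proof.
rewrite rcons_path size_rcons; case: s => [|z s] /=; first by constructor.
by case/andP=> /andP[_ pz] _; rewrite negbK; apply: paired_path.
Qed.

Lemma sub_paired (T : eqType) (e e' : rel T) s :
  {in s &, subrel e e'} -> paired e s -> paired e' s.
Proof.
move=> + ps; elim: ps => [|a b {}s eab _ IHs] sub; first by constructor.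
constructor; first by apply: sub; rewrite ?inE ?eqxx ?orbT.
by apply: IHs => u v us vs; apply: sub; rewrite !inE ?us ?vs !orbT.
Qed.

Lemma path_sub_in (T : eqType) (e e' : rel T) x s :
  {in x :: s &, subrel e e'} -> path e x s -> path e' x s.
Proof.
by move=> sub; apply: (sub_in_path (P := [in x :: s])) => //; apply/allP.
Qed.

Lemma path_coloring (T : Type) (e : rel T) (f : T -> bool) x s :
    (forall u v, e u v -> f u != f v) -> path e x s ->
  f (last x s) = f x (+) odd (size s).
Proof.
move=> fP; elim: s x => [|y s IHs] x /=; first by rewrite addbF.
by case/andP=> /fP fxy /IHs->; case: (f x) (f y) (odd _) fxy => [] [] [].
Qed.

Lemma paired_count (T : Type) (e : rel T) (f : T -> bool) s :
    (forall u v, e u v -> f u != f v) -> paired e s ->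
  forall b, (count (fun u => f u == b) s).*2 = size s.
Proof.
move=> fP ps b; elim: ps => //= u v {}s /fP fuv _ <-.
by case: b (f u) (f v) fuv => [] [] []//=; lia.
Qed.

Lemma paired_perfect_matching (G : sgraph) (s : seq G) :
    paired (@adj G) s -> uniq s -> s =i G ->
  exists M : {set {set G}}, perfect_matching M.
Proof.
move=> ps us sG.
(* The clause [set0 \notin M] is what [trivIsetU1] needs in order to add a pair. *)
suff [M [[ME tM] cM _]] : exists M : {set {set G}},
    [/\ matching M, cover M = [set x in s] & set0 \notin M].
  by exists M; split=> //; rewrite cM; apply/setP=> x; rewrite !inE sG.
elim: ps us {sG} => [|a b {}s eab _ IHs] /=.
  exists set0; rewrite inE; split=> //; first split; first exact: sub0set.
    by apply/trivIsetP=> A B; rewrite inE.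
  by apply/setP=> x; rewrite /cover big_set0 !inE.
rewrite inE negb_or -andbA => /and4P[_ as_ bs us].
have [M [[ME tM] cM M0]] := IHs us.
have [|tM' M'] := trivIsetU1 (A := [set a; b]) _ tM M0.
  move=> B BM; rewrite disjoint_subset; apply/subsetP=> x xab; rewrite inE.
  apply/negP=> xB; have: x \in cover M by apply/bigcupP; exists B.
  rewrite cM inE; move: xab; rewrite !inE => /orP[]/eqP->; exact/negP.
exists ([set a; b] |: M); split; first split=> //.
- rewrite subUset ME andbT sub1set; apply/imsetP; exists (a, b); rewrite ?inE // eab.
- apply/setP=> x; rewrite /cover big_setU1 //= -/(cover M) cM !inE.
  by rewrite orbA.
- rewrite !inE negb_or M0 andbT eq_sym; apply/set0Pn; exists a.
  by rewrite !inE eqxx.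
Qed.

(** * Bounds on independent sets *)

Lemma independentP (G : sgraph) (S : {set G}) :
  reflect {in S &, forall u v, ~~ adj u v} (independent S).
Proof.
apply: (iffP forall_inP) => [iS u v uS vS | iS u uS].
  by have /forall_inP := iS u uS; apply.
by apply/forall_inP=> v; apply: iS.
Qed.

Lemma paired_independent (G : sgraph) (s : seq G) (S : {set G}) :
  paired (@adj G) s -> independent S -> (count [in S] s).*2 <= size s.
Proof.
move=> + /independentP iS; elim=> //= a b {}s eab _ IHs.
have: ~~ ((a \in S) && (b \in S)) by apply/negP=> /andP[/iS h /h]; rewrite eab.
by case: (a \in S) (b \in S) => [] [] //= _; lia.
Qed.

Lemma card_count (T : finType) (s : seq T) (S : {set T}) :
  uniq s -> s =i T -> #|S| = count [in S] s.
Proof.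
move=> us sT; rewrite -size_filter -(card_uniqP _) ?filter_uniq //.
by apply: eq_card => x; rewrite mem_filter sT andbT.
Qed.

Lemma bicritical_independent (G : sgraph) (s : seq G) (S : {set G}) :
    bicritical2 G -> paired (@adj G) s -> uniq s -> s =i G -> 0 < #|G| ->
  independent S -> (#|S|.+1).*2 <= #|G|.
Proof.
move=> bi ps us sG G0 iS; have := paired_independent ps iS.
have szs : size s = #|G| by rewrite -(card_uniqP us); apply: eq_card.
(* Evenness sharpens [2|S| < |G|] to [2|S| + 2 <= |G|]. In the case of equality, [0 < #|G|] makes
   [S] nonempty, so that bicriticality applies. *)
have ev : ~~ odd (size s) by elim: (ps) => //= *; rewrite negbK.
rewrite -card_count // szs leq_eqVlt => /orP[/eqP eqS|]; last by lia.
have S0 : S != set0 by rewrite -card_gt0; lia.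
have := bi S S0 iS; have: #|neighbours S| <= #|~: S|.
  apply/subset_leq_card/subsetP=> w /bigcupP[v vS]; rewrite !inE => evw.
  by apply/negP=> wS; move/independentP: iS => /(_ v w vS wS); rewrite evw.
by have := cardsC S; lia.
Qed.

(** * Deleting one edge from each odd cycle *)

(** Here [x'] follows [x] on [c]: the edge between them will be deleted, and the even list [x' :: t]
    will be matched along the cycle, leaving [x] to the pendant path. *)
Lemma odd_cycle_rooted (G : sgraph) (c : seq G) x :
    odd_cycle c -> x \in c ->
  exists x' t, [/\ uniq (x :: x' :: t), c =i x :: x' :: t,
    path (@adj G) x (x' :: rcons t x), odd (size t)
    & [set x; x'] \in (cycle_graph c).2].
Proof.
case=> /andP[cyc uc] c2 oc xc; case: (rot_to xc) => i [|x' t] Dc.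
  by have := size_rot i c; rewrite Dc /=; lia.
exists x', t; split; rewrite -?Dc ?rot_uniq //.
- by move=> z; rewrite mem_rot.
- by have := cyc; rewrite -(rot_cycle i) Dc.
- by have := oc; rewrite -(size_rot i) Dc /= negbK.
apply/imsetP; exists x => //.
by rewrite -(next_rot i uc) Dc /= eqxx.
Qed.

Lemma set2_neq (T : finType) (a b u v : T) :
  a \notin [:: u; v] -> [set u; v] != [set a; b].
Proof.
apply: contraNneq => E; have : a \in [set u; v] by rewrite E set21.
by rewrite !inE.
Qed.

Definition delete_edges (G : sgraph) (D : {set {set G}}) : rel G :=
  [rel u v | adj u v && ([set u; v] \notin D)].

Lemma cycle_delete_edges (G : sgraph) (D : {set {set G}}) A c :
  cycle (delete_edges D) c -> A \in D -> A \notin (cycle_graph c).2.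
Proof.
move=> cyc AD; apply/negP=> /imsetP[z zc DA].
by have /andP[_] := next_cycle cyc zc; rewrite -DA AD.
Qed.

Lemma odd_linked_bipartition (G : sgraph) : odd_linked G ->
  exists (s : seq G) (f : G -> bool) x x' y y',
    [/\ paired (@adj G) s, uniq s, s =i G,
        forall b, #|[set u | f u == b]|.*2 = #|G|
      & [/\ x' != x /\ f x' = f x, y' != y /\ f y' = f y, f x != f y &
          forall u v, adj u v -> f u = f v ->
            [set u; v] \in [set [set x; x']; [set y; y']]]].
Proof.
case=> _ _ [C1 [C2 [_ C12]]] [p [H [p0 [c1 oc1 H0] add1 ears Hp]]].
case: add1 => c2 [x [s [y [[oc2 dis [pxy uxy] [xc2 yH0] sout] H1 osy]]]].
have memH0 z : (z \in (H 0).1) = (z \in c1) by rewrite H0 inE.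
have yc1 : y \in c1 by rewrite -memH0.
have [x' [t2 [u2 m2 p2 o2 e2]]] := odd_cycle_rooted oc2 xc2.
have [y' [t1 [u1 m1 p1 o1 e1]]] := odd_cycle_rooted oc1 yc1.
pose D := [set [set x; x']; [set y; y']].
pose e := delete_edges D.
have c2c1 z : z \in c2 -> z \in c1 = false by rewrite -memH0 => /dis/negbTE.
have disj z w : z \in c2 -> w \in c1 -> z != w.
  by move=> zc2; apply: contraTneq => <-; rewrite c2c1.
have x'c2 : x' \in c2 by rewrite m2 !inE eqxx orbT.
have y'c1 : y' \in c1 by rewrite m1 !inE eqxx orbT.
(* An edge survives the deletion as soon as it misses one end [r] of the first deleted edge and one
   end [q] of the second. *)
have eP r q u v : r \in [:: x; x'] -> q \in [:: y; y'] ->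
    r \notin [:: u; v] -> q \notin [:: u; v] -> adj u v -> e u v.
  move=> rx qy ruv quv auv; rewrite /e /delete_edges /= auv !inE negb_or.
  move: rx qy; rewrite !inE => /orP[]/eqP Dr /orP[]/eqP Dq; subst r q;
  by rewrite ?(set2_neq _ ruv) ?(set2_neq _ quv) // ?(setUC [set x]) ?(setUC [set y])
    ?(set2_neq _ ruv) ?(set2_neq _ quv).
have esym : symmetric e by move=> u v; rewrite /e /delete_edges /= adj_sym setUC.
have eirr : irreflexive e by move=> u; rewrite /e /delete_edges /= adj_irr.
(* Such a cycle, if odd, would be a third odd cycle of [G]: it lacks a deleted edge of [c1] and one
   of [c2]. *)
have noodd c : ucycle e c -> 2 < size c -> ~~ odd (size c).
  case/andP=> ec uc c3; apply/negP=> oc.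
  have oddc : odd_cycle c.
    by split=> //; rewrite /ucycle uc andbT (sub_cycle _ ec) // => u v /andP[].
  have graphs c' : odd_cycle c' -> cycle_graph c' = C1 \/ cycle_graph c' = C2.
    by move=> oc'; apply/C12; exists c'.
  have n1 : cycle_graph c <> cycle_graph c1.
    move=> E; have := cycle_delete_edges ec (set22 _ _ : [set y; y'] \in D).
    by rewrite E e1.
  have n2 : cycle_graph c <> cycle_graph c2.
    move=> E; have := cycle_delete_edges ec (set21 _ _ : [set x; x'] \in D).
    by rewrite E e2.
  have n12 : cycle_graph c1 <> cycle_graph c2.
    case=> /setP/(_ x) + _; rewrite !inE xc2; by rewrite c2c1.
  by case: (graphs _ oddc) (graphs _ oc1) (graphs _ oc2) => ? [] ? [] ?; congruence.
have [f fP] := no_odd_cycle_coloring esym eirr noodd.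
have sub z u : path (@adj G) z u -> forall r q, r \in [:: x; x'] ->
    q \in [:: y; y'] -> r \notin z :: u -> q \notin z :: u -> path e z u.
  move=> pu r q rx qy ru qu; apply: path_sub_in pu.
  move=> a b au bu; apply: (eP r q) => //; apply/negP; rewrite !inE.
    by move=> /orP[] /eqP E; case/negP: ru; rewrite E.
  by move=> /orP[] /eqP E; case/negP: qu; rewrite E.
(* Both cycles are treated alike. Going round from [a'] back to [a] without the deleted edge takes
   an even number of surviving edges, so the two ends get the same colour. *)
have cyc a a' t : uniq (a :: a' :: t) -> path (@adj G) a (a' :: rcons t a) ->
    odd (size t) ->
    (forall r u v, r \in [:: a; a'] -> u \in a :: a' :: t ->
      v \in a :: a' :: t -> r \notin [:: u; v] -> adj u v -> e u v) ->
  paired e (a' :: t) /\ f a' = f a.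
  case/andP=> aN /andP[a'N ut] /= /andP[_]; rewrite rcons_path => /andP[pt la] ot lift.
  have pe : path e a' t.
    apply: path_sub_in (pt).
    move=> u v ut' vt'; apply: (lift a); rewrite ?inE ?eqxx //.
    - by rewrite -in_cons ut' orbT.
    - by rewrite -in_cons vt' orbT.
    - by apply/negP=> /orP[]/eqP E; case/negP: aN; rewrite E.
  split; first exact: paired_path.
  have el : e (last a' t) a.
    apply: (lift a'); rewrite ?inE ?eqxx ?orbT //.
      by rewrite -in_cons mem_last orbT.
    rewrite negb_or [a' == a]eq_sym; move: aN; rewrite inE negb_or => /andP[-> _].
    rewrite andbT; case/lastP: (t) ot a'N => // t0 z _.
    by rewrite last_rcons mem_rcons inE negb_or => /andP[].
  have := path_coloring fP pe; rewrite ot; move: (fP _ _ el).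
  by case: (f a) (f a') (f _) => [] [] [].
have [|pd1 f1] := cyc _ _ _ u1 p1 o1.
  move=> r u v ry; rewrite -!m1 => uc vc; apply: (eP x r) => //.
    exact: mem_head.
  by rewrite !inE negb_or !disj.
have [|pd2 f2] := cyc _ _ _ u2 p2 o2.
  move=> r u v rx; rewrite -!m2 => uc vc rN; apply: (eP r y) => //.
    exact: mem_head.
  by rewrite !inE negb_or ![y == _]eq_sym !disj.
(* The pendant path meets [c2] only in [x] and [c1] only in [y], so it misses [x'] and [y']. *)
have pe : path e x (rcons s y).
  apply: (sub _ _ pxy x' y'); rewrite ?inE ?eqxx ?orbT //.
    rewrite mem_rcons in_cons !negb_or (disj x' y) // eq_sym.
    move: u2 => /= /andP[]; rewrite inE negb_or => /andP[-> _] _ /=.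
    by apply/negP=> /sout[_]; rewrite x'c2.
  rewrite mem_rcons in_cons !negb_or [y' == x]eq_sym disj //= eq_sym.
  move: u1 => /= /andP[]; rewrite inE negb_or => /andP[-> _] _ /=.
  by apply/negP=> /sout[]; rewrite memH0 y'c1.
have fxy : f x != f y.
  have := path_coloring fP pe; rewrite last_rcons osy => ->.
  by case: (f x).
suff [L [pL uL LG]] : exists L, [/\ paired e L, uniq L & L =i G].
  exists L, f, x, x', y, y'; split=> //.
  - by apply: sub_paired pL => u v _ _ /andP[].
  - move=> b; rewrite (card_count _ uL LG).
    rewrite -[RHS](eq_card LG) (card_uniqP uL) -(paired_count fP pL b).
    by congr _.*2; apply: eq_count => u; rewrite !inE.
  have ne (a a' : G) t : uniq [:: a, a' & t] -> a' != a.
    by move=> /= /andP[]; rewrite inE negb_or eq_sym => /andP[].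
  split=> //; [exact: (conj (ne _ _ _ u2) f2) | exact: (conj (ne _ _ _ u1) f1) |].
  move=> u v auv fuv; apply: contraT => uvD.
  by have := fP u v; rewrite fuv eqxx /e /delete_edges /= auv uvD => /(_ isT).
(* The invariant keeps [x] and [y] in [L]: the interior of a later ear then avoids both, and its
   edges survive by [eP]. *)
suff /(_ p) [||L [pL uL LH _]] : forall i, 0 < i -> i <= p -> exists L,
    [/\ paired e L, uniq L, L =i (H i).1 & (x \in L) && (y \in L)] => //.
  by exists L; split=> // z; rewrite LH Hp !inE.
elim=> // [[_ _ _|i IHi _ ip]].
  (* The three blocks are [c1] without [y], [c2] without [x], and the whole pendant path. *)
  exists ((y' :: t1) ++ (x' :: t2) ++ x :: rcons s y); split.
  - by do ![apply: paired_cat => //]; apply: paired_path.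
  - have zP z : z \in x :: rcons s y -> [\/ z = x, z = y | z \in s].
      by rewrite in_cons mem_rcons in_cons => /or3P[/eqP->|/eqP->|]; constructor.
    have [/andP[yN u1'] /andP[xN u2']] := (u1, u2).
    rewrite !cat_uniq uxy [uniq (y' :: t1)]u1' [uniq (x' :: t2)]u2'.
    rewrite !andbT !andTb; apply/andP; split; apply/hasPn=> z.
      have t1c w : w \in y' :: t1 -> w \in c1 by move=> wt; rewrite m1 in_cons wt orbT.
      rewrite mem_cat => /orP[zt|].
        by apply/negP=> /t1c; rewrite c2c1 // m2 in_cons zt orbT.
      case/zP=> [->|->|/sout[]] //.
        by apply/negP=> /t1c; rewrite c2c1.
      by rewrite memH0 => zc _; apply: contra zc => /t1c.
    have t2c w : w \in x' :: t2 -> w \in c2 by move=> wt; rewrite m2 in_cons wt orbT.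
    case/zP=> [->|->|/sout[]] //.
      by apply/negP=> /t2c /c2c1; rewrite yc1.
    by move=> _ zc; apply: contra zc => /t2c.
  - move=> z; rewrite H1 !(mem_cat, inE, mem_rcons) memH0 m1 m2 !inE.
    case: (z == y); case: (z == y'); case: (z \in t1); case: (z == x);
    by case: (z == x'); case: (z \in t2); case: (z \in s).
  - by rewrite !(mem_cat, inE, mem_rcons) !eqxx !orbT.
have [//||L [pL uL LH /andP[xL yL]]] := IHi; first exact: ltnW.
have [|a [s0 [b [[pab odd0 [aH bH] us0 s0H] HE]]]] := ears i.+2; first by rewrite ip.
have s0L : {in s0, forall z, z \notin L} by move=> z /s0H; rewrite LH.
exists (s0 ++ L); split.
- apply: paired_cat pL; apply: sub_paired (paired_internal pab odd0) => u v us vs.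
  have nL w : w \in L -> w \notin [:: u; v].
    move=> wL; rewrite !inE; apply/negP=> /orP[]/eqP E;
    by move: wL; rewrite E; apply/negP; apply: s0L.
  by apply: (eP x y); rewrite ?mem_head ?nL.
- rewrite cat_uniq us0 uL andbT; apply/hasPn=> z zL.
  by apply/negP=> /s0L; rewrite zL.
- move=> z; rewrite HE !(mem_cat, inE, mem_rcons) LH /=.
  have [->|_] := eqVneq z a; first by rewrite aH !orbT.
  have [->|_] := eqVneq z b; first by rewrite bH !orbT.
  exact: orbC.
- by rewrite !mem_cat xL yL !orbT.
Qed.

(** * Maximum independent sets from the colour classes *)

(** Every edge inside the class of [a] has [a] as an end. *)
Lemma independent_class_minus (G : sgraph) (f : G -> bool) a a' :
    f a' = f a ->
    (forall u v, adj u v -> f u = f a -> f v = f a -> [set u; v] = [set a; a']) ->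
  independent ([set u | f u == f a] :\ a).
Proof.
move=> fa aP; apply/independentP=> u v; rewrite !inE.
case/andP=> ua /eqP fu /andP[va /eqP fv]; apply/negP=> /aP/(_ fu fv) E.
have : a \in [set u; v] by rewrite E set21.
by rewrite !inE ![a == _]eq_sym (negbTE ua) (negbTE va).
Qed.

Theorem theorem5p1 (G : sgraph) (n : nat) (hG : odd_linked G) (hn : #|G| = n) :
  [/\ exists M : {set {set G}}, perfect_matching M,
      ((alpha G)%:R = (n%:R - 2%:R) / 2%:R :> rat)%R,
      core G = set0
    & corona G = [set: G]].
Proof.
have [_ bi _ _] := hG.
have [s [f [x [x' [y [y' [ps us sG cardf [[x'x fx] [y'y fy] fxy fD]]]]]]]] :=
  odd_linked_bipartition hG.
have G0 : 0 < #|G| by apply/card_gt0P; exists x.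
have ub (S : {set G}) : independent S -> (#|S|.+1).*2 <= #|G|.
  by move=> iS; exact: (bicritical_independent bi ps us sG G0 iS).
have in_class a a' v : a' != a -> f a' = f a -> f v = f a ->
    (forall u w, adj u w -> f u = f a -> f w = f a -> [set u; w] = [set a; a']) ->
  exists S : {set G}, [/\ independent S, v \in S & (#|S|.+1).*2 = #|G|].
  have drop b b' : f b' = f b -> f v = f b -> v != b ->
      (forall u w, adj u w -> f u = f b -> f w = f b -> [set u; w] = [set b; b']) ->
    exists S : {set G}, [/\ independent S, v \in S & (#|S|.+1).*2 = #|G|].
    move=> fb fv vb bP; exists ([set u | f u == f b] :\ b); split.
    - exact: independent_class_minus fb bP.
    - by rewrite !inE vb fv /=.
    - by rewrite -(cardf (f b)) (cardsD1 b [set u | _]) inE eqxx.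
  (* The dropped end must differ from [v]: it is [a], unless [v] is [a] itself, and then [a']. *)
  move=> a'a fa fv aP; have [va|va] := eqVneq v a; last exact: (drop a a').
  apply: (drop a' a); rewrite ?fa ?va // 1?eq_sym // => u w auw fu fw.
  by rewrite [RHS]setUC; apply: aP.
have cover_max v : exists S : {set G},
    [/\ independent S, v \in S & (#|S|.+1).*2 = #|G|].
  have [fvx|fvx] := eqVneq (f v) (f x).
    apply: (in_class x x') => // u w auw fu fw.
    have := fD u w auw; rewrite fu fw !inE => /(_ erefl)/orP[]/eqP // E.
    (* The other deleted edge cannot lie in this class, since [y] has the opposite colour. *)
    have : y \in [set u; w] by rewrite E set21.
    by rewrite !inE => /orP[]/eqP Dy; case/eqP: fxy; rewrite Dy.
  apply: (in_class y y') => //; first by move: fvx fxy; do 3!case: (f _).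
  move=> u w auw fu fw.
  have := fD u w auw; rewrite fu fw !inE => /(_ erefl)/orP[]/eqP // E.
  have : x \in [set u; w] by rewrite E set21.
  by rewrite !inE => /orP[]/eqP Dx; case/eqP: fxy; rewrite Dx.
have alphaE : (alpha G).+1.*2 = #|G|.
  have [S [iS _ cS]] := cover_max x; have leS : #|S| <= alpha G.
    exact: leq_bigmax_cond.
  suff : alpha G <= #|S| by lia.
  by apply/bigmax_leqP=> R /ub; lia.
have max_set v : exists2 S, S \in max_independent_sets G & v \in S.
  have [S [iS vS cS]] := cover_max v; exists S => //.
  by rewrite inE iS /=; apply/eqP; lia.
split.
- exact: paired_perfect_matching ps us sG.
- rewrite -hn -alphaE doubleS -muln2 -addn2 GRing.natrD GRing.addrK GRing.natrM.
  by rewrite GRing.mulfK.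
(* Bicriticality of the singleton gives [v] a neighbour [w]. Some maximum independent set contains
   [w], and a core vertex [v] would lie in it too. *)
- apply/setP=> v; rewrite inE; apply/negP=> /bigcapP vcore.
  have iv : independent [set v].
    by apply/independentP=> a b; rewrite !inE => /eqP-> /eqP->; rewrite adj_irr.
  have v0 : [set v] != set0 by apply/set0Pn; exists v; rewrite inE.
  have /card_gt0P[w /bigcupP[u]] := leq_ltn_trans (leq0n _) (bi _ v0 iv).
  rewrite !inE => /eqP-> avw; have [S maxS wS] := max_set w.
  have := maxS; rewrite inE => /andP[/independentP iS _].
  by have := iS v w (vcore S maxS) wS; rewrite avw.
- apply/setP=> v; rewrite inE; apply/bigcupP.
  by have [S maxS vS] := max_set v; exists S.
Qed.
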